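(* Assume $m\le n$, $R\succeq I$, $Q\succeq I$, $(A_\star,B_\star)$ stabilizable, and $\|A_\star\|,\|B_\star\|,\|P_\star\|\le\Upsilon_\star$ with $\Upsilon_\star\ge\max\{1,\varepsilon_\mathrm{m}\}$. Let $(\hat A,\hat B)$ satisfy $\max\{\|\hat A-A_\star\|,\|\hat B-B_\star\|\}\le\varepsilon_\mathrm{m}$, let $P\in\mathbb{S}^n_+$ with $\|P-P_\star\|\le\varepsilon_\mathrm{p}$ ($\varepsilon_\mathrm{p}\ge0$), and let $i\ge0$ be an integer. If $\varepsilon_\mathrm{m}<1/(8\|P_\star\|^2)$ and $\gamma_1(\varepsilon_\mathrm{m},\varepsilon_\mathrm{p})\gamma_2(\varepsilon_\mathrm{m})<1$, then $$\|\mathcal{R}^{(i)}_{\hat A,\hat B}(P)-P_\star\|\le\widehat E(\varepsilon_\mathrm{m},\varepsilon_\mathrm{p},i):=\sqrt{\alpha_{\varepsilon_\mathrm{m}}}\,\beta_\star\Big\{(\gamma_1\gamma_2)^i\varepsilon_\mathrm{p}+\tilde\psi(\varepsilon_\mathrm{m})\frac{1-(\gamma_1\gamma_2)^i}{1-\gamma_1\gamma_2}\Big\},$$ with $\gamma_1=\gamma_1(\varepsilon_\mathrm{m},\varepsilon_\mathrm{p})$, $\gamma_2=\gamma_2(\varepsilon_\mathrm{m})$.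
   Context: $A_\star,\hat A\in\mathbb{R}^{n\times n}$, $B_\star,\hat B\in\mathbb{R}^{n\times m}$, weights $Q\in\mathbb{S}^n_+$, $R\in\mathbb{S}^m_{++}$; $\|\cdot\|$ spectral norm; $\overline\sigma,\underline\sigma$ largest/smallest singular values. $S_B=BR^{-1}B^\top$; Riccati map $\mathcal{R}_{A,B}(P)=A^\top P(I+S_BP)^{-1}A+Q$, iterates $\mathcal{R}^{(0)}=\mathrm{id}$, $\mathcal{R}^{(i+1)}=\mathcal{R}\circ\mathcal{R}^{(i)}$. $P_\star$ is the unique positive definite solution of $P_\star=\mathcal{R}_{A_\star,B_\star}(P_\star)$; $\beta_\star=\overline{\sigma}(P_\star)/\underline{\sigma}(Q)$. Define $\psi(\varepsilon_\mathrm{m},\varepsilon_\mathrm{p})=\varepsilon_\mathrm{m}[1+(\varepsilon_\mathrm{m}+2\Upsilon_\star)^2(\beta_\star\varepsilon_\mathrm{p}+\Upsilon_\star)]$, $\gamma_1(\varepsilon_\mathrm{m},\varepsilon_\mathrm{p})=\sqrt{\beta_\star}\psi(\varepsilon_\mathrm{m},\varepsilon_\mathrm{p})+\sqrt{1-\beta_\star^{-1}}$, $\alpha_{\varepsilon_\mathrm{m}}=(1-8\|P_\star\|^2\varepsilon_\mathrm{m})^{-1/2}$, $\gamma_2(\varepsilon_\mathrm{m})=\sqrt{1-\alpha_{\varepsilon_\mathrm{m}}^{-1}\beta_\star^{-1}}$, and $\tilde\psi(\varepsilon_\mathrm{m})=(\varepsilon_\mathrm{m}^2+2\Upsilon_\star\varepsilon_\mathrm{m})[\Upsilon_\star+(\varepsilon_\mathrm{m}+\Upsilon_\star)^2\Upsilon_\star^2]$.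 *)

(* Defs.v *)
From HB Require Import structures.
From mathcomp Require Import all_boot all_order all_algebra.
From mathcomp Require Import complex.
From mathcomp Require Import classical_sets reals.
Set Implicit Arguments. Unset Strict Implicit. Unset Printing Implicit Defensive.
Import Order.TTheory GRing.Theory Num.Theory.
Local Open Scope ring_scope.
Local Open Scope classical_set_scope.
Local Open Scope complex_scope.

Definition vnorm (R : realType) (k : nat) (x : 'cV[R]_k) : R :=
  Num.sqrt (\sum_(i < k) x i 0 ^+ 2).

Definition specnorm (R : realType) (p q : nat) (A : 'M[R]_(p, q)) : R :=
  sup [set vnorm (A *m x) | x in [set x : 'cV[R]_q | vnorm x <= 1]].

(* smallest singular value of a square matrix = inf_{|x|=1} |Ax| *)
Definition minsv (R : realType) (k : nat) (A : 'M[R]_k) : R :=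
  inf [set vnorm (A *m x) | x in [set x : 'cV[R]_k | vnorm x = 1]].

Definition symmetric (R : realType) (k : nat) (A : 'M[R]_k) : Prop := A^T = A.

Definition psd (R : realType) (k : nat) (A : 'M[R]_k) : Prop :=
  symmetric A /\ forall x : 'cV[R]_k, 0 <= (x^T *m A *m x) 0 0.

Definition pd (R : realType) (k : nat) (A : 'M[R]_k) : Prop :=
  symmetric A /\ forall x : 'cV[R]_k, x != 0 -> 0 < (x^T *m A *m x) 0 0.

Definition schur_stable (R : realType) (k : nat) (M : 'M[R]_k) : Prop :=
  forall z : R[i], eigenvalue (map_mx (fun x : R => x%:C) M) z -> `|z| < 1.

Definition stabilizable (R : realType) (n m : nat)
  (A : 'M[R]_n) (B : 'M[R]_(n, m)) : Prop :=
  exists K : 'M[R]_(m, n), schur_stable (A + B *m K).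

Definition SB (R : realType) (n m : nat) (Rw : 'M[R]_m) (B : 'M[R]_(n, m)) :
  'M[R]_n := B *m invmx Rw *m B^T.

Definition riccati (R : realType) (n m : nat) (Q : 'M[R]_n) (Rw : 'M[R]_m)
  (A : 'M[R]_n) (B : 'M[R]_(n, m)) (P : 'M[R]_n) : 'M[R]_n :=
  A^T *m P *m invmx (1%:M + SB Rw B *m P) *m A + Q.

Definition riccati_iter (R : realType) (n m : nat) (Q : 'M[R]_n) (Rw : 'M[R]_m)
  (A : 'M[R]_n) (B : 'M[R]_(n, m)) (i : nat) (P : 'M[R]_n) : 'M[R]_n :=
  iter i (riccati Q Rw A B) P.

Section Consts.
Variables (R : realType).
Definition psi_fn (Ups beta em ep : R) : R :=
  em * (1 + (em + 2 * Ups) ^+ 2 * (beta * ep + Ups)).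
Definition gamma1 (Ups beta em ep : R) : R :=
  Num.sqrt beta * psi_fn Ups beta em ep + Num.sqrt (1 - beta^-1).
Definition alpha_fn (normPs em : R) : R :=
  (Num.sqrt (1 - 8 * normPs ^+ 2 * em))^-1.
Definition gamma2 (normPs beta em : R) : R :=
  Num.sqrt (1 - (alpha_fn normPs em)^-1 * beta^-1).
Definition psitilde (Ups em : R) : R :=
  (em ^+ 2 + 2 * Ups * em) * (Ups + (em + Ups) ^+ 2 * Ups ^+ 2).
Definition Ehat (Ups normPs beta em ep : R) (i : nat) : R :=
  let g := gamma1 Ups beta em ep * gamma2 normPs beta em in
  Num.sqrt (alpha_fn normPs em) * beta *
   (g ^+ i * ep + psitilde Ups em * ((1 - g ^+ i) / (1 - g))).
End Consts.

(* Main.v *)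
(** The value [x^T (riccati X) x] is the minimum over [u] of
    [<Ax+Bu, Ax+Bu>_X + <u, u>_Rw + <x, x>_Q].  This turns every estimate into
    one about a single state and input, and gives a scalar recursion: if
    [(1 - s) Ps <= X <= (1 + s) Ps] then the same holds for the perturbed
    Riccati image of [X] with [s] replaced by [g s + psitilde / minsv Q], where
    [g = gamma1 * gamma2].
    The upper bound uses the input that is optimal for the true system at [Ps]:
    the perturbed successor state contracts in the [Ps]-norm both by [gamma1]
    (triangle inequality) and by [gamma2] (the perturbation is absorbed by a
    fraction of the stage cost), hence its square by [g].
    The lower bound uses concavity of the Riccati map and [g >= 1 - 1 / beta]. *)

Require Import Defs.
From HB Require Import structures.
From mathcomp Require Import all_boot all_order all_algebra.
From mathcomp Require Import classical_sets reals.
From mathcomp Require Import ring lra.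
Import Order.TTheory GRing.Theory Num.Theory.
Local Open Scope ring_scope.

(** * Bilinear forms and the Euclidean norm *)

Definition bil {R : realType} {k : nat} (X : 'M[R]_k) (x y : 'cV[R]_k) : R :=
  (x^T *m X *m y) 0 0.

Section BilinearForms.
Context {R : realType} {k : nat}.
Implicit Types (X Y : 'M[R]_k) (x y z : 'cV[R]_k) (a : R).

Lemma bilDl X x y z : bil X (x + y) z = bil X x z + bil X y z.
Proof. by rewrite /bil raddfD /= !mulmxDl mxE. Qed.

Lemma bilDr X x y z : bil X x (y + z) = bil X x y + bil X x z.
Proof. by rewrite /bil !mulmxDr mxE. Qed.

Lemma bilZl X a x y : bil X (a *: x) y = a * bil X x y.
Proof. by rewrite /bil linearZ /= -!scalemxAl mxE. Qed.

Lemma bilZr X a x y : bil X x (a *: y) = a * bil X x y.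
Proof. by rewrite /bil -!scalemxAr mxE. Qed.

Lemma bilNl X x y : bil X (- x) y = - bil X x y.
Proof. by rewrite -scaleN1r bilZl mulN1r. Qed.

Lemma bilNr X x y : bil X x (- y) = - bil X x y.
Proof. by rewrite -scaleN1r bilZr mulN1r. Qed.

Lemma bil_addm X Y x y : bil (X + Y) x y = bil X x y + bil Y x y.
Proof. by rewrite /bil mulmxDr mulmxDl mxE. Qed.

Lemma bil_subm X Y x y : bil (X - Y) x y = bil X x y - bil Y x y.
Proof. by rewrite /bil mulmxBr mulmxBl !mxE. Qed.

Lemma bil_tr X x y : bil X x y = bil X^T y x.
Proof.
rewrite /bil -[LHS](mxE trmx_key (fun i j => (x^T *m X *m y) j i)).
by rewrite -/(trmx _) !trmx_mul trmxK mulmxA.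
Qed.

Lemma bilC X x y : Defs.symmetric X -> bil X x y = bil X y x.
Proof. by move=> sX; rewrite bil_tr sX. Qed.

Lemma bil_sqrD X x y : Defs.symmetric X ->
  bil X (x + y) (x + y) = bil X x x + 2 * bil X x y + bil X y y.
Proof. by move=> sX; rewrite !(bilDl, bilDr) (bilC _ y x sX); lra. Qed.

Lemma bil_mulr X x y : bil X x y = bil 1%:M x (X *m y).
Proof. by rewrite /bil mulmx1 mulmxA. Qed.

Lemma psd_bil_ge0 X x : psd X -> 0 <= bil X x x.
Proof. by move=> [_ h]; exact: h. Qed.

Lemma bil1C x y : bil 1%:M x y = bil 1%:M y x.
Proof. by apply: bilC; exact: trmx1. Qed.

Lemma bil1E x : bil 1%:M x x = \sum_(i < k) x i 0 ^+ 2.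
Proof.
by rewrite /bil mulmx1 mxE; apply: eq_bigr => i _; rewrite mxE expr2.
Qed.

Lemma psd1 : psd (1%:M : 'M[R]_k).
Proof.
split; first exact: trmx1.
by move=> x; rewrite -/(bil _ x x) bil1E sumr_ge0 // => i _; exact: sqr_ge0.
Qed.

Lemma bil1_ge0 x : 0 <= bil 1%:M x x.
Proof. exact: psd_bil_ge0 psd1. Qed.

Lemma bil1_eq0 x : bil 1%:M x x = 0 -> x = 0.
Proof.
rewrite bil1E => /eqP; rewrite psumr_eq0; last by move=> i _; exact: sqr_ge0.
move=> /allP h; apply/matrixP => i j; rewrite ord1 mxE.
by have := h i (mem_index_enum _); rewrite sqrf_eq0 => /eqP.
Qed.

(** When [bil X y y > 0], expand the form at [bil X y y *: x - bil X x y *: y]. The case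
    [bil X x x > 0] follows by symmetry. When both vanish, nonnegativity at [x + y] and [x - y]
    forces [bil X x y = 0]. *)
Lemma cauchy_schwarz X x y : psd X ->
  bil X x y ^+ 2 <= bil X x x * bil X y y.
Proof.
move=> pX; have sX := pX.1.
have key u v : 0 < bil X v v -> bil X u v ^+ 2 <= bil X u u * bil X v v.
  move=> v0; have := psd_bil_ge0 _ (bil X v v *: u - bil X u v *: v) pX.
  rewrite !(bilDl, bilDr, bilNl, bilNr, bilZl, bilZr) (bilC _ v u sX) => h.
  by rewrite -(ler_pM2l v0); lra.
have [y0|y0] := ltP 0 (bil X y y); first exact: key.
have [x0|x0] := ltP 0 (bil X x x).
  by rewrite (bilC _ x y sX) mulrC; exact: key.
have hx := psd_bil_ge0 _ x pX; have hy := psd_bil_ge0 _ y pX.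
have := psd_bil_ge0 _ (x + y) pX; have := psd_bil_ge0 _ (x - y) pX.
rewrite !(bilDl, bilDr, bilNl, bilNr) (bilC _ y x sX) => h1 h2.
have -> : bil X x y = 0 by lra.
by rewrite expr0n /=; nra.
Qed.

(** Cauchy-Schwarz through squares: cross terms later get rational constants [c], with only
    [e * f <= c ^+ 2] left to check. *)
Lemma bil_sqr_bound X x y (c e f : R) : psd X -> 0 <= c -> 0 <= e ->
  bil X x x <= e -> bil X y y <= f -> e * f <= c ^+ 2 ->
  `|bil X x y| <= c.
Proof.
move=> pX c0 e0 he hf hc.
rewrite -(@ler_pXn2r _ 2) ?nnegrE //.
rewrite real_normK ?num_real //; apply: le_trans hc.
apply: (le_trans (cauchy_schwarz _ x y pX)).
by apply: ler_pM => //; exact: psd_bil_ge0.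
Qed.

Lemma sqr_vnorm x : vnorm x ^+ 2 = bil 1%:M x x.
Proof. by rewrite /vnorm sqr_sqrtr -bil1E // bil1_ge0. Qed.

Lemma vnorm0 : vnorm (0 : 'cV[R]_k) = 0.
Proof.
apply/eqP; rewrite -sqrf_eq0 sqr_vnorm; apply/eqP.
by rewrite /bil mulmx0 mxE.
Qed.

Lemma vnorm_ge0 x : 0 <= vnorm x.
Proof. exact: sqrtr_ge0. Qed.

Lemma vnormZ a x : vnorm (a *: x) = `|a| * vnorm x.
Proof.
apply/eqP; rewrite -(@eqrXn2 _ 2) ?mulr_ge0 ?vnorm_ge0 //.
by rewrite exprMn !sqr_vnorm bilZl bilZr real_normK ?num_real // mulrA expr2.
Qed.

Lemma vnorm_eq0 x : vnorm x = 0 -> x = 0.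
Proof. by move=> h; apply: bil1_eq0; rewrite -sqr_vnorm h expr0n. Qed.

Lemma vnorm_le x c : 0 <= c -> (vnorm x <= c) = (bil 1%:M x x <= c ^+ 2).
Proof. by move=> c0; rewrite -sqr_vnorm ler_pXn2r ?nnegrE ?vnorm_ge0. Qed.

End BilinearForms.

(** * Spectral norm and smallest singular value *)

Section SpectralNorm.
Context {R : realType}.

(** The Frobenius norm is an upper bound, by Cauchy-Schwarz applied to each row of [A]. *)
Lemma specnorm_has_sup p q (A : 'M[R]_(p, q)) :
  has_sup [set vnorm (A *m x) | x in [set x : 'cV[R]_q | vnorm x <= 1]]%classic.
Proof.
split.
  exists (vnorm (A *m 0)); exists 0 => //=.
  by rewrite vnorm0 ler01.
exists (Num.sqrt (\sum_(i < p) bil 1%:M (row i A)^T (row i A)^T)).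
have s0 : 0 <= \sum_(i < p) bil 1%:M (row i A)^T (row i A)^T.
  by apply: sumr_ge0 => i _; exact: bil1_ge0.
move=> _ [x /= hx <-]; rewrite vnorm_le ?sqrtr_ge0 // sqr_sqrtr // bil1E.
apply: ler_sum => i _.
have -> : (A *m x) i 0 = bil 1%:M (row i A)^T x.
  rewrite /bil trmxK mulmx1 !mxE; apply: eq_bigr => j _.
  by rewrite mxE.
apply: (le_trans (cauchy_schwarz _ _ _ psd1)).
rewrite -[leRHS]mulr1; apply: ler_wpM2l; first exact: bil1_ge0.
by move: hx; rewrite vnorm_le // expr1n.
Qed.

Lemma specnorm_ge0 p q (A : 'M[R]_(p, q)) : 0 <= specnorm A.
Proof.
apply: le_trans (vnorm_ge0 (A *m 0)) _.
apply: sup_upper_bound; first exact: specnorm_has_sup.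
by exists 0 => //=; rewrite vnorm0 ler01.
Qed.

Lemma vnorm_mulmx p q (A : 'M[R]_(p, q)) x :
  vnorm (A *m x) <= specnorm A * vnorm x.
Proof.
have [/vnorm_eq0 ->|x0] := eqVneq (vnorm x) 0.
  by rewrite mulmx0 !vnorm0 mulr0.
have xp : 0 < vnorm x by rewrite lt_def x0 vnorm_ge0.
rewrite -ler_pdivrMr //.
have -> : vnorm (A *m x) / vnorm x = vnorm (A *m ((vnorm x)^-1 *: x)).
  by rewrite -scalemxAr vnormZ ger0_norm ?invr_ge0 ?vnorm_ge0 // mulrC.
apply: sup_upper_bound; first exact: specnorm_has_sup.
exists ((vnorm x)^-1 *: x) => //=.
by rewrite vnormZ ger0_norm ?invr_ge0 ?vnorm_ge0 // mulVf.
Qed.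

Lemma specnorm_le p q (A : 'M[R]_(p, q)) c : 0 <= c ->
  (forall x, vnorm (A *m x) <= c * vnorm x) -> specnorm A <= c.
Proof.
move=> c0 h; apply: ge_sup; first by case: (specnorm_has_sup _ _ A).
move=> _ [x /= hx <-]; apply: (le_trans (h x)).
by rewrite -[leRHS]mulr1; exact: ler_wpM2l.
Qed.

Lemma bil1_mulmx_le p q (A : 'M[R]_(p, q)) x c : specnorm A <= c ->
  bil 1%:M (A *m x) (A *m x) <= c ^+ 2 * bil 1%:M x x.
Proof.
move=> hc; have c0 := le_trans (specnorm_ge0 _ _ A) hc.
rewrite -!sqr_vnorm -exprMn ler_pXn2r ?nnegrE ?mulr_ge0 ?vnorm_ge0 //.
by apply: (le_trans (vnorm_mulmx _ _ A x)); apply: ler_wpM2r; rewrite ?vnorm_ge0.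
Qed.

Lemma bil_le_specnorm k (X : 'M[R]_k) x :
  `|bil X x x| <= specnorm X * bil 1%:M x x.
Proof.
rewrite bil_mulr; have h := bil1_mulmx_le _ _ X x _ (lexx (specnorm X)).
apply: (bil_sqr_bound _ _ _ _ _ _ psd1 _ (bil1_ge0 x) (lexx _) h).
  by rewrite mulr_ge0 ?specnorm_ge0 ?bil1_ge0.
by rewrite exprMn mulrCA expr2 -expr2.
Qed.

(* Polarisation at [x] and [t *: (D *m x)], with [t = 1 / c]. *)
Lemma specnorm_le_symmetric k (D : 'M[R]_k) c : Defs.symmetric D -> 0 <= c ->
  (forall x, `|bil D x x| <= c * bil 1%:M x x) -> specnorm D <= c.
Proof.
move=> sD c0 h; apply: specnorm_le => // x.
rewrite vnorm_le ?mulr_ge0 ?vnorm_ge0 // exprMn sqr_vnorm.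
set y := D *m x.
have pol t : 4 * t * bil 1%:M y y <= 2 * c * (bil 1%:M x x + t ^+ 2 * bil 1%:M y y).
  have := h (x + t *: y); have := h (x - t *: y).
  rewrite !ler_norml => /andP[h1 _] /andP[_ h2]; move: h1 h2.
  have -> : bil 1%:M y y = bil D x y.
    by rewrite (bilC _ _ _ sD) [RHS]bil_mulr.
  rewrite !(bilDl, bilDr, bilNl, bilNr, bilZl, bilZr) (bilC _ y x sD).
  rewrite (bil1C y x).
  have -> : bil 1%:M y y = bil D x y.
    by rewrite (bilC _ _ _ sD) [RHS]bil_mulr.
  by move=> h1 h2; lra.
(* For [c = 0] the choice [t = 1 / c] makes no sense, but [t = 1] already forces
   [bil 1%:M y y <= 0]. *)
have [c1|c1] := ltP 0 c; last first.
  have -> : c = 0 by apply/le_anti; rewrite c1.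
  have := pol 1; have -> : c = 0 by apply/le_anti; rewrite c1.
  by have := bil1_ge0 y; lra.
have := pol c^-1; rewrite -(ler_pM2l c1).
have -> : c * (4 / c * bil 1%:M y y) = 4 * bil 1%:M y y by field; lra.
have -> : c * (2 * c * (bil 1%:M x x + c^-1 ^+ 2 * bil 1%:M y y)) =
  2 * c ^+ 2 * bil 1%:M x x + 2 * bil 1%:M y y by field; lra.
by lra.
Qed.

Lemma bil1_le_psd_sub k (Q : 'M[R]_k) x : psd (Q - 1%:M) ->
  bil 1%:M x x <= bil Q x x.
Proof. by move=> h; have := psd_bil_ge0 _ x h; rewrite bil_subm subr_ge0. Qed.

(** A row [v] of the kernel of [Q^T] satisfies [Q *m v^T = 0], hence [|v|^2 <= <v, v>_Q = 0]. *)
Lemma unitmx_ge1 k (Q : 'M[R]_k) : psd (Q - 1%:M) -> Q \in unitmx.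
Proof.
move=> h; rewrite -unitmx_tr -row_free_unit -kermx_eq0.
apply/eqP/row_matrixP => i; rewrite row0.
have : row i (kermx Q^T) *m Q^T = 0 by rewrite -row_mul mulmx_ker row0.
set v := row i _ => hv; rewrite -[v]trmxK [v^T](_ : _ = 0) ?trmx0 //.
apply: bil1_eq0; apply/le_anti; rewrite bil1_ge0 andbT.
apply: (le_trans (bil1_le_psd_sub _ _ v^T h)).
rewrite /bil -mulmxA -[Q]trmxK -trmx_mul hv.
by rewrite trmx0 mulmx0 mxE.
Qed.

Lemma minsv_mulmx k (Q : 'M[R]_k) x : minsv Q * vnorm x <= vnorm (Q *m x).
Proof.
have [x0|x0] := eqVneq (vnorm x) 0; first by rewrite x0 mulr0 vnorm_ge0.
have xp : 0 < vnorm x by rewrite lt_def x0 vnorm_ge0.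
rewrite -ler_pdivlMr //.
have -> : vnorm (Q *m x) / vnorm x = vnorm (Q *m ((vnorm x)^-1 *: x)).
  by rewrite -scalemxAr vnormZ ger0_norm ?invr_ge0 ?vnorm_ge0 // mulrC.
apply: ge_inf.
  by exists 0 => _ [y _ <-]; exact: vnorm_ge0.
exists ((vnorm x)^-1 *: x) => //=.
by rewrite vnormZ ger0_norm ?invr_ge0 ?vnorm_ge0 // mulVf.
Qed.

(** For a unit vector, [1 <= <x, Q x> <= |Q x|] by Cauchy-Schwarz. The dimension is a successor so
    that unit vectors exist; otherwise the infimum would run over the empty set. *)
Lemma minsv_ge1 k (Q : 'M[R]_k.+1) : psd (Q - 1%:M) -> 1 <= minsv Q.
Proof.
move=> h; apply: lb_le_inf.
  pose e : 'cV[R]_k.+1 := delta_mx 0 0.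
  have e0 : vnorm e != 0.
    apply/eqP => /vnorm_eq0 /matrixP /(_ 0 0); rewrite !mxE !eqxx => /eqP.
    by rewrite oner_eq0.
  exists (vnorm (Q *m ((vnorm e)^-1 *: e))); exists ((vnorm e)^-1 *: e) => //=.
  by rewrite vnormZ ger0_norm ?invr_ge0 ?vnorm_ge0 // mulVf.
move=> _ [x /= hx <-].
have x1 : bil 1%:M x x = 1 by rewrite -sqr_vnorm hx expr1n.
have h1 := bil1_le_psd_sub _ _ x h; rewrite x1 bil_mulr in h1.
have := cauchy_schwarz _ x (Q *m x) psd1; rewrite x1 mul1r -sqr_vnorm => h2.
have := vnorm_ge0 (Q *m x); nra.
Qed.

(* With [Q *m z = x]: [|x|^4 = <x, z>_Q^2 <= <x, x>_Q <z, x> <= <x, x>_Q |x|^2 / minsv Q]. *)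
Lemma minsv_le_bil k (Q : 'M[R]_k) x : psd Q -> psd (Q - 1%:M) ->
  0 < minsv Q -> minsv Q * bil 1%:M x x <= bil Q x x.
Proof.
move=> pQ h s0; have uQ := unitmx_ge1 _ _ h.
set z := invmx Q *m x; have Qz : Q *m z = x by rewrite mulKVmx.
have hz := minsv_mulmx _ Q z; rewrite Qz in hz.
have cs := cauchy_schwarz _ x z pQ.
rewrite bil_mulr Qz in cs.
rewrite (bil_mulr Q z z) Qz in cs.
have cs1 := cauchy_schwarz _ z x psd1.
rewrite -!sqr_vnorm in cs1; rewrite -!sqr_vnorm in cs *.
have [x0|x0] := eqVneq (vnorm x) 0.
  by rewrite x0 expr0n mulr0; exact: psd_bil_ge0.
have xp : 0 < vnorm x by rewrite lt_def x0 vnorm_ge0.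
have z0 := vnorm_ge0 z; have q0 := psd_bil_ge0 _ x pQ.
have zx : bil 1%:M z x <= vnorm z * vnorm x.
  rewrite -exprMn in cs1; apply: le_trans (ler_norm _) _.
  by rewrite -(@ler_pXn2r _ 2) ?nnegrE ?mulr_ge0 ?vnorm_ge0 // real_normK ?num_real.
have c2 : vnorm x ^+ 4 <= bil Q x x * (vnorm z * vnorm x).
  by apply: le_trans (ler_wpM2l q0 zx); lra.
have c3 : minsv Q * vnorm x ^+ 4 <= bil Q x x * (vnorm x * vnorm x).
  apply: le_trans (ler_wpM2l (ltW s0) c2) _.
  rewrite mulrCA; apply: ler_wpM2l => //; rewrite mulrA.
  by apply: ler_wpM2r => //; exact: ltW.
have x2 : 0 < vnorm x * vnorm x by rewrite mulr_gt0.
by rewrite -(ler_pM2r x2); lra.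
Qed.

End SpectralNorm.

(** * The Riccati map as the value of a one-step control problem *)

Definition stage_cost {R : realType} {n m : nat} (Q : 'M[R]_n) (Rw : 'M[R]_m)
  (x : 'cV[R]_n) (u : 'cV[R]_m) : R := bil Rw u u + bil Q x x.

Section Riccati.
Context {R : realType} {n m : nat}.
Variables (Q : 'M[R]_n) (Rw : 'M[R]_m).
Hypotheses (psdQ : psd Q) (psdRw : psd Rw).
Hypothesis Rw_ge1 : psd (Rw - 1%:M).
Implicit Types (A X : 'M[R]_n) (B : 'M[R]_(n, m)).

Let uRw : Rw \in unitmx. Proof. exact: unitmx_ge1. Qed.

Lemma tr_invmx_Rw : (invmx Rw)^T = invmx Rw.
Proof. by rewrite trmx_inv psdRw.1. Qed.

Lemma SB_sym B : (SB Rw B)^T = SB Rw B.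
Proof. by rewrite /SB !trmx_mul trmxK tr_invmx_Rw mulmxA. Qed.

(* A null vector [v] satisfies [v = - B u] with [Rw u = B^T X v], whence
   [<u, u>_Rw = - <v, v>_X <= 0]. *)
Lemma unitmx_riccati B X : psd X -> 1%:M + SB Rw B *m X \in unitmx.
Proof.
move=> pX; rewrite -unitmx_tr -row_free_unit -kermx_eq0.
apply/eqP/row_matrixP => i; rewrite row0.
set M := 1%:M + _.
have : row i (kermx M^T) *m M^T = 0 by rewrite -row_mul mulmx_ker row0.
set w := row i _ => hw; rewrite -[w]trmxK [w^T](_ : _ = 0) ?trmx0 //.
set v := w^T; have Mv : M *m v = 0.
  by rewrite -[M]trmxK -trmx_mul hw trmx0.
set u := invmx Rw *m (B^T *m (X *m v)).
have vE : v = - (B *m u).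
  apply/eqP; rewrite -addr_eq0 -Mv /M mulmxDl mul1mx /SB /u !mulmxA.
  exact: eqxx.
have uE : bil Rw u u = - bil X v v.
  rewrite {2}/bil {1}vE linearN /= !mulNmx mxE opprK.
  rewrite trmx_mul -!mulmxA /bil -mulmxA; congr ((_ *m _) _ _).
  by rewrite /u mulKVmx.
have u0 : u = 0.
  apply: bil1_eq0; apply/le_anti; rewrite bil1_ge0 andbT.
  apply: (le_trans (bil1_le_psd_sub _ _ u Rw_ge1)); rewrite uE oppr_le0.
  exact: psd_bil_ge0.
by rewrite vE u0 mulmx0 oppr0.
Qed.

(** Push-through identity: with [M = 1 + S X] and [N = 1 + X S = M^T] one has [N X = X M], so the
    transpose [N^-1 X] of [X M^-1] equals [X M^-1]. *)
Lemma riccati_sym A B X : psd X -> Defs.symmetric (riccati Q Rw A B X).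
Proof.
move=> pX; have uM := unitmx_riccati B X pX.
rewrite /Defs.symmetric /riccati linearD /= psdQ.1; congr (_ + _).
rewrite !trmx_mul trmxK trmx_inv pX.1 linearD /= trmx1 trmx_mul SB_sym pX.1.
set M := 1%:M + SB Rw B *m X in uM *.
set N := 1%:M + X *m SB Rw B.
rewrite !mulmxA; congr (_ *m _); rewrite -!mulmxA; congr (_ *m _).
have uN : N \in unitmx.
  rewrite -unitmx_tr /N linearD /= trmx1 trmx_mul SB_sym pX.1; exact: uM.
have NX : N *m X = X *m M by rewrite mulmxDl mulmxDr mul1mx mulmx1 mulmxA.
by rewrite -[LHS](mulmxK uM) -(mulmxA _ X M) -NX mulKmx.
Qed.

(** Completing the square around the Riccati feedback [u], whose successor state is [v = M^-1 A x].
    Moving the input by [d] raises the cost by exactly [<B d, B d>_X + <d, d>_Rw]. *)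
Lemma riccati_opt A B X x : psd X ->
  exists2 u, bil (riccati Q Rw A B X) x x =
      bil X (A *m x + B *m u) (A *m x + B *m u) + stage_cost Q Rw x u &
    forall u', bil (riccati Q Rw A B X) x x <=
      bil X (A *m x + B *m u') (A *m x + B *m u') + stage_cost Q Rw x u'.
Proof.
move=> pX; have uM := unitmx_riccati B X pX.
set M := 1%:M + SB Rw B *m X in uM.
set v := invmx M *m (A *m x).
set u := - (invmx Rw *m (B^T *m (X *m v))).
have vE : A *m x + B *m u = v.
  have -> : A *m x = M *m v by rewrite mulKVmx.
  by rewrite /M mulmxDl mul1mx /u mulmxN /SB !mulmxA addrK.
(* First-order optimality of [u]: the derivative of the cost in the direction [d] vanishes. *)
have ortho d : bil X (B *m d) v = - bil Rw d u.
  have Ru : Rw *m u = - (B^T *m (X *m v)) by rewrite /u mulmxN mulKVmx.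
  by rewrite [bil Rw d u]/bil -mulmxA Ru mulmxN mxE opprK /bil trmx_mul !mulmxA.
have ricE : bil (riccati Q Rw A B X) x x = bil X v v + stage_cost Q Rw x u.
  rewrite /riccati bil_addm /stage_cost addrA; congr (_ + _).
  transitivity (bil X (A *m x) v).
    by rewrite /bil trmx_mul !mulmxA.
  have -> : A *m x = v - B *m u by rewrite -vE addrK.
  by rewrite bilDl bilNl ortho opprK.
exists u; first by rewrite vE.
move=> u'; rewrite ricE /stage_cost.
have -> : A *m x + B *m u' = v + B *m (u' - u) by rewrite -vE mulmxBr -addrA (addrC (B *m u)) subrK.
have -> : bil Rw u' u' = bil Rw (u + (u' - u)) (u + (u' - u)) by rewrite addrC subrK.
move: (u' - u) => d.
rewrite !bilDl !bilDr (bilC X v _ pX.1) ortho (bilC Rw u d psdRw.1).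
have := psd_bil_ge0 X (B *m d) pX; have := psd_bil_ge0 Rw d psdRw; lra.
Qed.

Lemma psd_riccati A B X : psd X -> psd (riccati Q Rw A B X).
Proof.
move=> pX; split; first exact: riccati_sym.
move=> x; rewrite -/(bil _ x x); have [u -> _] := riccati_opt A B X x pX.
by rewrite /stage_cost !addr_ge0 //; exact: psd_bil_ge0.
Qed.

Lemma psd_riccati_iter A B X i : psd X -> psd (riccati_iter Q Rw A B i X).
Proof. by move=> pX; elim: i => //= i IH; exact: psd_riccati. Qed.

End Riccati.

(** The closed form in [Ehat], divided by [c], solves the recursion [s' = q s + t / c] that drives
    the induction on the iterates. *)
Lemma geometric_bound_step (F : fieldType) (q e t c : F) (i : nat) :
  q != 1 -> c != 0 ->
  (q ^+ i.+1 * e + t * ((1 - q ^+ i.+1) / (1 - q))) / c =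
  q * ((q ^+ i * e + t * ((1 - q ^+ i) / (1 - q))) / c) + t / c.
Proof.
by move=> q1 c0; rewrite exprS; field; rewrite subr_eq0 (eq_sym 1) q1 c0.
Qed.

(** * One step of the perturbed system, measured at [Ps] *)

Section Perturbation.
Context {R : realType} {n m : nat}.
Variables (As Ah : 'M[R]_n) (Bs Bh : 'M[R]_(n, m)).
Variables (Q : 'M[R]_n) (Rw : 'M[R]_m) (Ps : 'M[R]_n) (Ups em ep : R).
Hypotheses (psdQ : psd Q) (psdRw : psd Rw) (psdPs : psd Ps).
Hypotheses (Rw_ge1 : psd (Rw - 1%:M)) (Q_ge1 : psd (Q - 1%:M)).
Hypothesis PsE : Ps = riccati Q Rw As Bs Ps.
Hypotheses (Ps_le : specnorm Ps <= Ups) (Ups_ge1 : 1 <= Ups) (em_ge0 : 0 <= em).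
Hypotheses (dA_le : specnorm (Ah - As) <= em) (dB_le : specnorm (Bh - Bs) <= em).

Local Notation cost := (stage_cost Q Rw).
Let dist x u : 'cV[R]_n := (Ah - As) *m x + (Bh - Bs) *m u.

Lemma stage_cost_ge (x : 'cV[R]_n) (u : 'cV[R]_m) :
  bil 1%:M x x + bil 1%:M u u <= cost x u.
Proof.
rewrite /stage_cost addrC.
have := bil1_le_psd_sub _ _ x Q_ge1; have := bil1_le_psd_sub _ _ u Rw_ge1; lra.
Qed.

(** [|a + b|^2 <= 2 |a|^2 + 2 |b|^2], and the stage cost dominates [|x|^2 + |u|^2]. *)
Lemma dist_le x u : bil 1%:M (dist x u) (dist x u) <= 2 * em ^+ 2 * cost x u.
Proof.
have hA := bil1_mulmx_le _ _ _ x _ dA_le; have hB := bil1_mulmx_le _ _ _ u _ dB_le.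
have := bil1_ge0 ((Ah - As) *m x - (Bh - Bs) *m u).
rewrite /dist; move: (_ *m x) (_ *m u) hA hB => a b hA hB.
rewrite !(bilDl, bilDr, bilNl, bilNr) (bil1C b a) => h.
have := ler_wpM2l (sqr_ge0 em) (stage_cost_ge x u); nra.
Qed.

Lemma bil_Ps_le x : bil Ps x x <= specnorm Ps * bil 1%:M x x.
Proof. exact: le_trans (ler_norm _) (bil_le_specnorm _ _ _). Qed.

(** The hypothesis bounds both [<a, a>_Ps] and the stage cost by [Ups |x|^2], and Cauchy-Schwarz
    handles the cross term. The state [a] is kept arbitrary: the upper estimate uses the true
    successor, the lower one the perturbed successor. *)
Lemma residual_le (a x : 'cV[R]_n) (u : 'cV[R]_m) :
  bil Ps a a + cost x u <= bil Ps x x ->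
  bil Ps (dist x u) (dist x u) + 2 * `|bil Ps a (dist x u)|
    <= psitilde Ups em * bil 1%:M x x.
Proof.
have U1 := Ups_ge1; have e0 := em_ge0.
move=> hx; set d := dist x u.
have x0 := bil1_ge0 x; have u0 := bil1_ge0 u; have a0 := psd_bil_ge0 _ a psdPs.
have U0 : 0 <= Ups by lra.
have hw := stage_cost_ge x u.
have hP y : bil Ps y y <= Ups * bil 1%:M y y.
  by apply: (le_trans (bil_Ps_le y)); apply: ler_wpM2r; rewrite ?bil1_ge0.
have hPx := hP x; have hPd := hP d; have hd := dist_le x u; rewrite -/d in hd.
set N := bil 1%:M x x in x0 hw hPx *.
have wN : cost x u <= Ups * N by lra.
have aN : bil Ps a a <= Ups * N by lra.
have e2 := sqr_ge0 em.
have dN : bil Ps d d <= 2 * Ups ^+ 2 * em ^+ 2 * N.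
  apply: (le_trans hPd); have := ler_wpM2l e2 wN => h.
  have : bil 1%:M d d <= 2 * em ^+ 2 * (Ups * N) by lra.
  by move=> /(ler_wpM2l U0); lra.
(* [3 / 2] is a rational number above the square root of 2; since [Ups >= 1], it absorbs
   [2 * Ups ^+ 3 <= 9 / 4 * Ups ^+ 4]. *)
have cross : `|bil Ps a d| <= 3 / 2 * Ups ^+ 2 * em * N.
  apply: (bil_sqr_bound _ _ _ _ _ _ psdPs _ _ aN dN).
  - by rewrite !mulr_ge0 ?sqr_ge0 //; lra.
  - exact: mulr_ge0.
  rewrite -subr_ge0 (_ : _ - _ = (Ups * em * N) ^+ 2 * Ups * (9 / 4 * Ups - 2)); last by field.
  by rewrite !mulr_ge0 ?sqr_ge0 //; lra.
(* The second factor of [psitilde] is at least [Ups + Ups ^+ 4 >= 2 * Ups ^+ 2]; then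
   [4 * Ups ^+ 3 >= 3 * Ups ^+ 2] settles the term linear in [em]. *)
have pt : 2 * Ups ^+ 2 * em ^+ 2 + 3 * Ups ^+ 2 * em <= psitilde Ups em.
  rewrite /psitilde.
  have c1 : Ups ^+ 4 <= (em + Ups) ^+ 2 * Ups ^+ 2.
    rewrite (_ : Ups ^+ 4 = Ups ^+ 2 * Ups ^+ 2); last by ring.
    apply: ler_wpM2r; first exact: sqr_ge0.
    by rewrite ler_pXn2r ?nnegrE //; lra.
  have c2 : 2 * Ups ^+ 2 <= Ups + Ups ^+ 4.
    rewrite -subr_ge0 (_ : _ - _ = Ups * (Ups - 1) * (Ups ^+ 2 + (Ups - 1))); last by ring.
    have U2 : 0 <= Ups - 1 by lra.
    by rewrite !mulr_ge0 // addr_ge0 ?sqr_ge0.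
  have c3 : 0 <= em ^+ 2 + 2 * Ups * em by rewrite addr_ge0 // !mulr_ge0 //; lra.
  apply: (@le_trans _ _ ((em ^+ 2 + 2 * Ups * em) * (2 * Ups ^+ 2))); last first.
    by apply: ler_wpM2l => //; lra.
  have : 0 <= Ups ^+ 2 * em * (4 * Ups - 3) by rewrite !mulr_ge0 ?sqr_ge0 //; lra.
  by lra.
by have := ler_wpM2r x0 pt; lra.
Qed.

(** The Bellman equation of the true system: [riccati_opt] at the fixed point. *)
Lemma Ps_opt x : exists2 u,
  bil Ps x x = bil Ps (As *m x + Bs *m u) (As *m x + Bs *m u) + cost x u &
  forall u', bil Ps x x <=
    bil Ps (As *m x + Bs *m u') (As *m x + Bs *m u') + cost x u'.
Proof. by have := riccati_opt Q Rw psdRw Rw_ge1 As Bs Ps x psdPs; rewrite -PsE. Qed.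

Lemma perturbed_inputE x u : Ah *m x + Bh *m u = As *m x + Bs *m u + dist x u.
Proof. by rewrite /dist !mulmxBl addrACA !subrKC. Qed.

(** If the image exceeds [Ps] at [x], nothing is left to show. Otherwise its optimal input meets the
    hypothesis of [residual_le], and the same input on the true system costs at least
    [<x, x>_Ps]. *)
Lemma riccati_Ps_lower x :
  bil Ps x x - psitilde Ups em * bil 1%:M x x <= bil (riccati Q Rw Ah Bh Ps) x x.
Proof.
have U1 := Ups_ge1; have e0 := em_ge0.
have pt0 : 0 <= psitilde Ups em.
  by rewrite /psitilde !(mulr_ge0, addr_ge0, sqr_ge0) //; lra.
have [u hu _] := riccati_opt Q Rw psdRw Rw_ge1 Ah Bh Ps x psdPs.
have [hlt|hge] := ltP (bil Ps x x) (bil (riccati Q Rw Ah Bh Ps) x x).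
  by have := mulr_ge0 pt0 (bil1_ge0 x); lra.
rewrite hu in hge *.
have := residual_le _ _ _ hge; have [_ _ /(_ u)] := Ps_opt x.
rewrite perturbed_inputE; move: (As *m x + _) (dist x u) => a d.
rewrite !(bilDl, bilDr, bilNl, bilNr) (bilC _ d a psdPs.1) => h1 h2.
have := ler_norm (bil Ps a d + bil Ps d d); have := ler_norm (- (bil Ps a d + bil Ps d d)).
rewrite normrN; lra.
Qed.

(** * Contraction rates in the [Ps]-norm *)

Let sig := minsv Q.
Let p := specnorm Ps.
Let beta := p / sig.
Let g := gamma1 Ups beta em ep * gamma2 p beta em.
Hypotheses (sig_ge1 : 1 <= sig) (ep_ge0 : 0 <= ep) (em_lt : em < (8 * p ^+ 2)^-1).
Hypothesis p_ge : sig <= p.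

Let sig_gt0 : 0 < sig. Proof. exact: lt_le_trans sig_ge1. Qed.
Let p_gt0 : 0 < p. Proof. exact: lt_le_trans p_ge. Qed.

Lemma beta_inv : beta^-1 = sig / p.
Proof. by rewrite /beta invf_div. Qed.

Lemma beta_ge1 : 1 <= beta.
Proof. by rewrite /beta ler_pdivlMr // mul1r. Qed.

Lemma beta_inv01 : 0 <= beta^-1 <= 1.
Proof.
have b1 := beta_ge1; have b0 : 0 < beta := lt_le_trans ltr01 b1.
by rewrite invr_ge0 invf_le1 // b1 ltW.
Qed.

Lemma em_small : 8 * p ^+ 2 * em < 1.
Proof.
have h : 0 < 8 * p ^+ 2 by rewrite mulr_gt0 // exprn_gt0.
by rewrite mulrC -ltr_pdivlMr // mul1r.
Qed.

(** [alpha^-1] is a square root of the form [sqrt (1 - 8 t)], which lies below its tangent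
    [1 - 4 t]. *)
Lemma alpha_inv : [/\ 0 <= (alpha_fn p em)^-1, (alpha_fn p em)^-1 <= 1
  & (alpha_fn p em)^-1 <= 1 - 4 * p ^+ 2 * em].
Proof.
rewrite /alpha_fn invrK; have h := em_small.
have pe : 0 <= p ^+ 2 * em by rewrite mulr_ge0 ?sqr_ge0.
have r : Num.sqrt (1 - 8 * p ^+ 2 * em) <= 1 - 4 * p ^+ 2 * em.
  rewrite -(@ler_pXn2r _ 2) ?nnegrE ?sqrtr_ge0 //; last by lra.
  by rewrite sqr_sqrtr; [have := sqr_ge0 (p ^+ 2 * em); lra|lra].
by split=> //; [exact: sqrtr_ge0|lra].
Qed.

Lemma alpha_ge1 : 1 <= alpha_fn p em.
Proof.
have [_ r1 _] := alpha_inv; rewrite -[alpha_fn p em]invrK invf_ge1 //.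
by rewrite /alpha_fn invrK sqrtr_gt0 subr_gt0 em_small.
Qed.

Lemma bil_Ps_ge x : sig * bil 1%:M x x <= bil Ps x x.
Proof.
have [u -> _] := Ps_opt x; rewrite /stage_cost.
have := minsv_le_bil _ _ x psdQ Q_ge1 sig_gt0.
rewrite -/sig.
have := psd_bil_ge0 _ (As *m x + Bs *m u) psdPs; have := psd_bil_ge0 _ u psdRw; lra.
Qed.

(** Together with [cost_ge], this says that a single stage costs at least the fraction [1 / beta] of
    [<x, x>_Ps]. *)
Lemma beta_inv_bil_Ps x : beta^-1 * bil Ps x x <= sig * bil 1%:M x x.
Proof.
rewrite beta_inv mulrAC -mulrA; apply: ler_wpM2l; first exact: ltW.
by rewrite ler_pdivrMr // mulrC; exact: bil_Ps_le.
Qed.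

Lemma cost_ge x u : sig * bil 1%:M x x <= cost x u.
Proof.
rewrite /stage_cost.
have := minsv_le_bil _ _ x psdQ Q_ge1 sig_gt0; rewrite -/sig.
have := psd_bil_ge0 _ u psdRw; lra.
Qed.

Lemma psi_ge : em * (1 + Ups) <= psi_fn Ups beta em ep.
Proof.
have U1 := Ups_ge1; have e0 := em_ge0.
rewrite /psi_fn; apply: ler_wpM2l => //; rewrite lerD2l.
have h : 1 <= (em + 2 * Ups) ^+ 2 by rewrite exprn_ege1 //; lra.
have be : 0 <= beta * ep by rewrite mulr_ge0 //; have := beta_ge1; lra.
apply: (@le_trans _ _ (1 * (beta * ep + Ups))); first by lra.
by apply: ler_wpM2r => //; lra.
Qed.

(** With [r = alpha^-1], the perturbation raises [<a, a>_Ps] by at most [(1 - r)] times the stage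
    cost [w]. What remains is [<x, x>_Ps - r w], and [w >= <x, x>_Ps / beta]. *)
Lemma contraction_gamma2 (x a : 'cV[R]_n) (u : 'cV[R]_m) :
  bil Ps x x = bil Ps a a + cost x u ->
  bil Ps (a + dist x u) (a + dist x u) <= gamma2 p beta em ^+ 2 * bil Ps x x.
Proof.
have s1 := sig_ge1; have sp := p_ge.
move=> hx; have [r0 r1 r2] := alpha_inv; have [b0 b1] := andP beta_inv01.
set r := (alpha_fn p em)^-1 in r0 r1 r2.
rewrite /gamma2 sqr_sqrtr; last first.
  by rewrite subr_ge0; apply: mulr_ile1.
have hb := beta_inv_bil_Ps x; have hc := cost_ge x u.
have hs := stage_cost_ge x u; have u0 := bil1_ge0 u; have x0 := bil1_ge0 x.
set w := cost x u in hx hc hs *.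
have w0 : 0 <= w by lra.
have key : bil Ps (a + dist x u) (a + dist x u) <= bil Ps a a + (1 - r) * w.
  set d := dist x u.
  have hd : bil 1%:M d d <= 2 * em ^+ 2 * w := dist_le x u.
  have hPd : bil Ps d d <= 2 * p * em ^+ 2 * w.
    apply: (le_trans (bil_Ps_le d)); rewrite -/p.
    by have := ler_wpM2l (ltW p_gt0) hd; lra.
  have hPa : bil Ps a a <= p * w.
    have h1 := bil_Ps_le x; rewrite -/p in h1.
    have : p * bil 1%:M x x <= p * w by apply: ler_wpM2l; [exact: ltW|lra].
    by lra.
  have cross : `|bil Ps a d| <= 3 / 2 * p * em * w.
    apply: (bil_sqr_bound _ _ _ _ _ _ psdPs _ _ hPa hPd).
    - by rewrite !mulr_ge0 //; lra.
    - by rewrite mulr_ge0 //; lra.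
    have := sqr_ge0 (p * em * w); lra.
  have p1 : 1 <= p by lra.
  (* From [p >= 1] and [8 * p ^+ 2 * em < 1] follows [em <= 1 / 8], so the left side is at most
     [4 * p ^+ 2 * em], the tangent bound of [alpha_inv]. *)
  have sm : 3 * p * em + 2 * p * em ^+ 2 <= 1 - r.
    have pe : 0 <= p * em by rewrite mulr_ge0 //; lra.
    have ppe : p * em <= p ^+ 2 * em.
      have : 0 <= p * em * (p - 1) by rewrite mulr_ge0 //; lra.
      by lra.
    have es := em_small.
    have ee : em <= 8^-1.
      have : 0 <= em * (p - 1) by rewrite mulr_ge0 //; lra.
      by lra.
    have : 0 <= p * em * (8^-1 - em) by rewrite mulr_ge0 //; lra.
    by lra.
  rewrite (bil_sqrD _ a d psdPs.1).
  have := ler_wpM2r w0 sm; have := ler_norm (bil Ps a d); lra.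
apply: (le_trans key).
have h1 : r * (beta^-1 * bil Ps x x) <= r * w by apply: ler_wpM2l => //; lra.
by rewrite -/r; lra.
Qed.

(** Triangle inequality in the [Ps]-norm: paying the stage cost leaves
    [|a| <= sqrt (1 - 1 / beta) |x|], while [|d| <= sqrt beta * psi_fn * |x|] for the perturbation
    [d]. *)
Lemma contraction_gamma1 (x a : 'cV[R]_n) (u : 'cV[R]_m) :
  bil Ps x x = bil Ps a a + cost x u ->
  bil Ps (a + dist x u) (a + dist x u) <= gamma1 Ups beta em ep ^+ 2 * bil Ps x x.
Proof.
have U1 := Ups_ge1; have e0 := em_ge0.
move=> hx; have [b0 b1] := andP beta_inv01; have bge := beta_ge1.
have hb := beta_inv_bil_Ps x; have hc := cost_ge x u.
have x0 := psd_bil_ge0 _ x psdPs.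
set N := bil Ps x x in hx hb x0 *; set d := dist x u.
set s1 := Num.sqrt beta * psi_fn Ups beta em ep.
set s2 := Num.sqrt (1 - beta^-1).
have psi0 : 0 <= psi_fn Ups beta em ep.
  by apply: le_trans psi_ge; rewrite mulr_ge0 //; lra.
have s10 : 0 <= s1 by rewrite mulr_ge0 ?sqrtr_ge0.
have s20 : 0 <= s2 := sqrtr_ge0 _.
have ha : bil Ps a a <= s2 ^+ 2 * N.
  by rewrite /s2 sqr_sqrtr; lra.
have hd : bil Ps d d <= s1 ^+ 2 * N.
  have h1 : cost x u <= Ups * bil 1%:M x x.
    have h := psd_bil_ge0 _ a psdPs; have h' := bil_Ps_le x; rewrite -/N in h'.
    by have := ler_wpM2r (bil1_ge0 x) Ps_le; lra.
  have h2 : bil 1%:M d d <= psi_fn Ups beta em ep ^+ 2 * bil 1%:M x x.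
    have e2 := sqr_ge0 em.
    have h3 : (em * (1 + Ups)) ^+ 2 <= psi_fn Ups beta em ep ^+ 2.
      by rewrite ler_pXn2r ?nnegrE ?psi_ge // mulr_ge0 //; lra.
    have := ler_wpM2r (bil1_ge0 x) h3; have := dist_le x u; rewrite -/d.
    have := ler_wpM2l e2 h1.
    (* [1 + Ups ^+ 2] is the gap between [(1 + Ups) ^+ 2] from [psi_ge] and the [2 * Ups] that
       [dist_le] and [h1] produce. *)
    have : 0 <= em ^+ 2 * (1 + Ups ^+ 2) * bil 1%:M x x.
      by rewrite !mulr_ge0 ?bil1_ge0 // addr_ge0 ?sqr_ge0.
    by lra.
  have h3 : bil 1%:M x x <= sig^-1 * N.
    by rewrite mulrC ler_pdivlMr // mulrC; exact: bil_Ps_ge.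
  rewrite /s1 exprMn sqr_sqrtr; last by lra.
  apply: (le_trans (bil_Ps_le d)).
  apply: (le_trans (ler_wpM2l (ltW p_gt0) h2)).
  set q := psi_fn _ _ _ _; have -> : beta * q ^+ 2 * N = p * (q ^+ 2 * (sig^-1 * N)).
    by rewrite /beta; ring.
  apply: ler_wpM2l; first exact: ltW.
  by apply: ler_wpM2l; first exact: sqr_ge0.
have cross : `|bil Ps a d| <= s2 * s1 * N.
  apply: (bil_sqr_bound _ _ _ _ _ _ psdPs _ _ ha hd).
  - exact: mulr_ge0 (mulr_ge0 s20 s10) x0.
  - exact: mulr_ge0 (sqr_ge0 _) x0.
  by rewrite le_eqVlt; apply/orP; left; apply/eqP; ring.
rewrite /gamma1 -/s1 -/s2 (bil_sqrD _ a d psdPs.1).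
have := ler_norm (bil Ps a d); lra.
Qed.

Lemma gamma1_ge : Num.sqrt (1 - beta^-1) <= gamma1 Ups beta em ep.
Proof.
have U1 := Ups_ge1; have e0 := em_ge0.
rewrite /gamma1 lerDr mulr_ge0 ?sqrtr_ge0 //.
by apply: le_trans psi_ge; rewrite mulr_ge0 //; lra.
Qed.

Lemma gamma2_ge : Num.sqrt (1 - beta^-1) <= gamma2 p beta em.
Proof.
have [b0 b1] := andP beta_inv01; have [r0 r1 _] := alpha_inv.
by rewrite /gamma2 ler_wsqrtr // lerD2l lerN2 ler_piMl.
Qed.

(** Both factors of [g] are at least [sqrt (1 - 1 / beta)]. This lets the lower estimate, which
    naturally has the rate [1 - 1 / beta], run at the rate [g]. *)
Lemma rate_ge : 1 - beta^-1 <= g.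
Proof.
have [b0 b1] := andP beta_inv01.
rewrite -[leLHS]sqr_sqrtr ?expr2; last by lra.
by apply: ler_pM; rewrite ?sqrtr_ge0 ?gamma1_ge ?gamma2_ge.
Qed.

Lemma contraction (x a : 'cV[R]_n) (u : 'cV[R]_m) :
  bil Ps x x = bil Ps a a + cost x u ->
  bil Ps (a + dist x u) (a + dist x u) <= g * bil Ps x x.
Proof.
move=> hx; have h1 := contraction_gamma1 _ _ _ hx.
have h2 := contraction_gamma2 _ _ _ hx.
have g1 : 0 <= gamma1 Ups beta em ep := le_trans (sqrtr_ge0 _) gamma1_ge.
have g2 : 0 <= gamma2 p beta em := sqrtr_ge0 _.
have x0 := psd_bil_ge0 _ x psdPs; have t0 := psd_bil_ge0 _ (a + dist x u) psdPs.
rewrite -(@ler_pXn2r _ 2) ?nnegrE ?mulr_ge0 //.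
apply: (le_trans (y := (gamma1 Ups beta em ep ^+ 2 * bil Ps x x) *
   (gamma2 p beta em ^+ 2 * bil Ps x x))); first by rewrite expr2; exact: ler_pM.
by rewrite le_eqVlt /g; apply/orP; left; apply/eqP; ring.
Qed.

(** * Propagation of two-sided bounds relative to [Ps] *)

Lemma psitilde_bil1 x :
  psitilde Ups em * bil 1%:M x x <= psitilde Ups em / sig * bil Ps x x.
Proof.
have U1 := Ups_ge1; have e0 := em_ge0.
rewrite -mulrA; apply: ler_wpM2l.
  by rewrite /psitilde !(mulr_ge0, addr_ge0, sqr_ge0) //; lra.
by rewrite mulrC ler_pdivlMr // mulrC; exact: bil_Ps_ge.
Qed.

Lemma psitilde_sig_ge0 : 0 <= psitilde Ups em / sig.
Proof.
have U1 := Ups_ge1; have e0 := em_ge0.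
rewrite divr_ge0 ?(ltW sig_gt0) //.
by rewrite /psitilde !(mulr_ge0, addr_ge0, sqr_ge0) //; lra.
Qed.

(** The true optimal input is tested on the perturbed system. In [(1 + s) <a + d, a + d>_Ps] the
    summand 1 is estimated by the residual, giving [psitilde / sig], and the summand [s] by
    [contraction], giving [g * s]. *)
Lemma riccati_upper X s : psd X -> 0 <= s ->
  (forall x, bil X x x <= (1 + s) * bil Ps x x) ->
  forall x, bil (riccati Q Rw Ah Bh X) x x
    <= (1 + (g * s + psitilde Ups em / sig)) * bil Ps x x.
Proof.
move=> pX s0 hX x; have [u hu _] := Ps_opt x.
have [_ _ /(_ u)] := riccati_opt Q Rw psdRw Rw_ge1 Ah Bh X x pX.
rewrite perturbed_inputE => hr; apply: (le_trans hr).
set a := As *m x + Bs *m u in hu *; have hXa := hX (a + dist x u).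
have hc := ler_wpM2l s0 (contraction _ _ _ hu).
have hu' : bil Ps a a + cost x u <= bil Ps x x by rewrite hu.
have hres := residual_le _ _ _ hu'; have hpt := psitilde_bil1 x.
have hE : bil Ps (a + dist x u) (a + dist x u) <=
  bil Ps a a + psitilde Ups em / sig * bil Ps x x.
  move: hres; rewrite (bil_sqrD _ a _ psdPs.1).
  by have := ler_norm (bil Ps a (dist x u)); lra.
lra.
Qed.

(* For [s <= 1] this is concavity of the Riccati map: the cost to go
   [(1 - s) Ps] costs at least [1 - s] times the optimum for [Ps] plus
   [s] times the stage cost.  For [s > 1] the stage cost alone suffices. *)
Lemma riccati_lower X s : psd X -> 0 <= s ->
  (forall x, (1 - s) * bil Ps x x <= bil X x x) ->
  forall x, (1 - (g * s + psitilde Ups em / sig)) * bil Ps x x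
    <= bil (riccati Q Rw Ah Bh X) x x.
Proof.
move=> pX s0 hX x; have [u -> _] := riccati_opt Q Rw psdRw Rw_ge1 Ah Bh X x pX.
set y := Ah *m x + Bh *m u; have hXy := hX y; have Xy0 := psd_bil_ge0 _ y pX.
have x0 := psd_bil_ge0 _ x psdPs.
have hw := le_trans (beta_inv_bil_Ps x) (cost_ge x u).
have hg := ler_wpM2r x0 rate_ge; have hpt := mulr_ge0 psitilde_sig_ge0 x0.
have [s1|s1] := leP s 1.
  have [_ _ /(_ u)] := riccati_opt Q Rw psdRw Rw_ge1 Ah Bh Ps x psdPs.
  rewrite -/y => hy; have hl := riccati_Ps_lower x; have hpx := psitilde_bil1 x.
  have s1' : 0 <= 1 - s by lra.
  have k1 : (1 - s) * (bil Ps x x - psitilde Ups em / sig * bil Ps x x) <=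
    (1 - s) * (bil Ps y y + cost x u) by apply: ler_wpM2l => //; lra.
  (* The stage cost taken [s] times returns [s / beta], and [1 - s + s / beta >= 1 - g * s] by
     [rate_ge]. *)
  have k2 := ler_wpM2l s0 hw; have k3 := ler_wpM2l s0 hg.
  have k4 := ler_wpM2l s0 hpt.
  lra.
have g0 : 0 <= g by apply: le_trans rate_ge; have [_ b1] := andP beta_inv01; lra.
have k1 : 0 <= g * (s - 1) * bil Ps x x by apply: mulr_ge0 => //; apply: mulr_ge0 => //; lra.
by lra.
Qed.

(** Induction along [s' = g s + psitilde / sig], started at [s = ep / sig]; [g != 1] gives its
    closed form a meaning. *)
Lemma riccati_iter_bounds X i : psd X -> specnorm (X - Ps) <= ep -> g != 1 ->
  let s := (g ^+ i * ep + psitilde Ups em * ((1 - g ^+ i) / (1 - g))) / sig in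
  [/\ 0 <= s,
    forall x, bil (riccati_iter Q Rw Ah Bh i X) x x <= (1 + s) * bil Ps x x &
    forall x, (1 - s) * bil Ps x x <= bil (riccati_iter Q Rw Ah Bh i X) x x].
Proof.
move=> pX hX g1; have g0 : 0 <= g.
  by apply: le_trans rate_ge; have [_ b1] := andP beta_inv01; lra.
elim: i => [|i [s0 hup hlo]] /=.
  rewrite expr0 subrr mul0r mulr0 addr0 mul1r.
  have key x : `|bil X x x - bil Ps x x| <= ep / sig * bil Ps x x.
    rewrite -bil_subm; apply: (le_trans (bil_le_specnorm _ _ _)).
    apply: (le_trans (ler_wpM2r (bil1_ge0 x) hX)).
    rewrite -mulrA; apply: ler_wpM2l => //.
    by rewrite mulrC ler_pdivlMr // mulrC; exact: bil_Ps_ge.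
  split; first by rewrite divr_ge0 // ltW.
  - by move=> x; have := key x; rewrite ler_norml => /andP[]; lra.
  - by move=> x; have := key x; rewrite ler_norml => /andP[]; lra.
have pXi := psd_riccati_iter Q Rw psdQ psdRw Rw_ge1 Ah Bh X i pX.
set s := (X in 0 <= X) in s0 hup hlo.
have sig_neq0 : sig != 0 by rewrite gt_eqF.
rewrite (geometric_bound_step _ _ _ _ _ _ g1 sig_neq0) -/s.
split; first by rewrite addr_ge0 ?psitilde_sig_ge0 // mulr_ge0.
- exact: riccati_upper.
- exact: riccati_lower.
Qed.

End Perturbation.

(** * From relative bounds on quadratic forms to the spectral norm *)

Theorem theorem2 (R : realType) (n m : nat)
  (As Ah : 'M[R]_n) (Bs Bh : 'M[R]_(n, m))
  (Q : 'M[R]_n) (Rw : 'M[R]_m) (Ps P : 'M[R]_n)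
  (Ups em ep : R) (i : nat) :
  (m <= n)%N ->
  psd Q -> psd Rw ->
  psd (Rw - 1%:M) -> psd (Q - 1%:M) ->
  stabilizable As Bs ->
  pd Ps -> Ps = riccati Q Rw As Bs Ps ->
  specnorm As <= Ups -> specnorm Bs <= Ups -> specnorm Ps <= Ups ->
  Num.max 1 em <= Ups ->
  Num.max (specnorm (Ah - As)) (specnorm (Bh - Bs)) <= em ->
  psd P -> 0 <= ep -> specnorm (P - Ps) <= ep ->
  let beta := specnorm Ps / minsv Q in
  em < (8 * specnorm Ps ^+ 2)^-1 ->
  gamma1 Ups beta em ep * gamma2 (specnorm Ps) beta em < 1 ->
  specnorm (riccati_iter Q Rw Ah Bh i P - Ps)
    <= Ehat Ups (specnorm Ps) beta em ep i.
Proof.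
move=> _ psdQ psdRw Rw_ge1 Q_ge1 _ pdPs PsE _ _ Ps_le.
rewrite !ge_max => /andP[Ups_ge1 _] /andP[dA_le dB_le] psdP ep_ge0 P_le beta em_lt g_lt1.
have em_ge0 : 0 <= em := le_trans (specnorm_ge0 _ _ _) dA_le.
have psdPs : psd Ps.
  split; first exact: pdPs.1.
  move=> x; have [->|x0] := eqVneq x 0; first by rewrite mulmx0 mxE.
  exact: ltW (pdPs.2 x x0).
(* As [0^-1 = 0], a vanishing norm would turn the smallness condition into [em < 0]. *)
have p_neq0 : specnorm Ps != 0.
  by apply: contraTneq em_lt => ->; rewrite expr0n mulr0 invr0 ltNge em_ge0.
(* In dimension 0 the spectral norm is 0, against [p_neq0]; the successor case supplies the unit
   vectors behind [minsv_ge1]. *)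
case: n => [|k] in As Ah Bs Bh Q Ps P psdQ Q_ge1 pdPs PsE Ps_le dA_le dB_le
    psdP P_le beta em_lt g_lt1 psdPs p_neq0 *.
  case/negP: p_neq0; apply/eqP/le_anti; rewrite specnorm_ge0 andbT.
  by apply: specnorm_le => // x; rewrite (flatmx0 x) mulmx0 vnorm0 mulr0.
have sig_ge1 := minsv_ge1 _ _ Q_ge1.
have p_ge : minsv Q <= specnorm Ps.
  (* At any nonzero [e], [minsv Q * |e|^2 <= <e, e>_Ps <= specnorm Ps * |e|^2]. *)
  pose e : 'cV[R]_k.+1 := delta_mx 0 0.
  have e_gt0 : 0 < bil 1%:M e e.
    rewrite lt_def bil1_ge0 andbT; apply/eqP => /bil1_eq0 /matrixP /(_ 0 0).
    by rewrite !mxE !eqxx => /eqP; rewrite oner_eq0.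
  rewrite -(ler_pM2r e_gt0); apply: le_trans (bil_Ps_le Ps e).
  exact: (bil_Ps_ge As Bs Q Rw).
have [] := riccati_iter_bounds As Ah Bs Bh Q Rw Ps Ups em ep
  psdQ psdRw psdPs Rw_ge1 Q_ge1 PsE Ps_le Ups_ge1 em_ge0 dA_le dB_le sig_ge1
  ep_ge0 em_lt p_ge P i psdP P_le (negbT (lt_eqF g_lt1)).
rewrite -/beta /Ehat; set E := _ + psitilde _ _ * _ => E0 hup hlo.
have sig_gt0 : 0 < minsv Q := lt_le_trans ltr01 sig_ge1.
(* The relative error [E / minsv Q] becomes absolute through [<x, x>_Ps <= specnorm Ps * |x|^2],
   which produces [beta]; [alpha >= 1] then leads from [beta * E] to [Ehat]. *)
have bE : E / minsv Q * specnorm Ps = beta * E by rewrite mulrC mulrA mulrAC.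
have bE0 : 0 <= beta * E by rewrite -bE mulr_ge0 ?specnorm_ge0.
have bE_le : beta * E <= Num.sqrt (alpha_fn (specnorm Ps) em) * beta * E.
  rewrite -mulrA ler_peMl // -sqrtr1 ler_wsqrtr //.
  exact: (alpha_ge1 Q).
have [symX _] := psd_riccati_iter Q Rw psdQ psdRw Rw_ge1 Ah Bh P i psdP.
apply: le_trans bE_le; apply: specnorm_le_symmetric => //.
  by rewrite /Defs.symmetric linearB /= symX psdPs.1.
move=> x; rewrite bil_subm -bE -(mulrA (E / minsv Q)).
apply: (@le_trans _ _ (E / minsv Q * bil Ps x x)); last first.
  by apply: ler_wpM2l; [|exact: bil_Ps_le].
by rewrite ler_norml; have := hup x; have := hlo x; lra.
Qed.
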